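(* There is a universal constant $C>0$ such that for every $1<p<\infty$, with $q=p/(p-1)$, there is a constant $\bar{C}_p$ depending only on $p$ and satisfying $$\bar{C}_p \le 4\,p^{1/p}q^{1/q}\left(1+\max\{(p-1)^{-1/p},(q-1)^{-1/q}\}\right)\le C\cdot\max\left\{\frac{1}{p-1},\frac{1}{q-1}\right\},$$ for which the following holds. For every integer $N\ge 1$ and all $W_1,\ldots,W_N>0$ there exists a linear operator $H:\mathbb{R}^{\partial V}\to\mathbb{R}^V$ such that: (1) $(Hf)(x)=f(x)$ for every $x\in\partial V$ and every $f:\partial V\to\mathbb{R}$; (2) for every $f:\partial V\to\mathbb{R}$, $$\|Hf\|_{\dot{W}^{1,p}(V)}\le \bar{C}_p\,\|f\|_{\dot{W}^{1,p}(\partial V)}.$$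
   Context: The full binary tree of height $N$ has vertex set $V=\bigcup_{k=0}^N\{0,1\}^k$ (binary strings of length at most $N$). For $x\in\{0,1\}^k$ and $\ell\le k$, $\pi_\ell(x)\in\{0,1\}^\ell$ is the prefix of $x$ of length $\ell$; for $k\ge1$ the parent of $x\in\{0,1\}^k$ is $\pi_{k-1}(x)$. The leaves are $\partial V=\{0,1\}^N$. $\mathbb{R}^V$ and $\mathbb{R}^{\partial V}$ are the spaces of real functions on $V$ and on $\partial V$. Given weights $W_1,\ldots,W_N>0$ and $1<p<\infty$, for $F:V\to\mathbb{R}$, $$\|F\|_{\dot{W}^{1,p}(V)}=\left(\sum_{k=1}^N W_k\sum_{x\in\{0,1\}^k}|F(x)-F(\pi_{k-1}(x))|^p\right)^{1/p},$$ and for $f:\partial V\to\mathbb{R}$, $$\|f\|_{\dot{W}^{1,p}(\partial V)}=\inf\{\|F\|_{\dot{W}^{1,p}(V)} : F:V\to\mathbb{R},\ F|_{\partial V}=f\}.$$ *)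

(* Defs.v *)
From HB Require Import structures.
From mathcomp Require Import all_boot all_order all_algebra.
From mathcomp Require Import all_classical all_reals all_analysis.

Set Implicit Arguments.
Unset Strict Implicit.
Unset Printing Implicit Defensive.

Import Order.TTheory GRing.Theory Num.Theory.

Local Open Scope classical_set_scope.
Local Open Scope ring_scope.

(* A leaf is regarded as a vertex through the coercion bseq_of_tuple. *)
Notation vertex N := (N.-bseq bool).
Notation leaf N := (N.-tuple bool).

Definition level (N k : nat) : {set vertex N} :=
  [set x : vertex N | size x == k]%SET.

(* The prefix of length l; it is x itself when l exceeds the length of x. *)
Definition prefix_of (N l : nat) (x : vertex N) : vertex N :=
  [bseq of take l x].

(* Only the values W 1, ..., W N are used. *)
Definition sobolev_norm (R : realType) (N : nat) (W : nat -> R) (p : R)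
    (F : vertex N -> R) : R :=
  (\sum_(1 <= k < N.+1)
     W k * \sum_(x in level N k) `|F x - F (prefix_of k.-1 x)| `^ p) `^ p^-1.

(* The set below is nonempty and bounded below by 0, so inf, which is total on
   sets of reals, is its infimum. *)
Definition trace_norm (R : realType) (N : nat) (W : nat -> R) (p : R)
    (f : leaf N -> R) : R :=
  inf [set sobolev_norm W p F |
        F in [set F : vertex N -> R | forall x : leaf N, F x = f x]].

(* Main.v *)
From HB Require Import structures.
Require Import Defs.
From mathcomp Require Import all_boot all_order all_algebra.
From mathcomp Require Import all_classical all_reals all_analysis.
From mathcomp Require Import ring lra zify.
Import Order.TTheory GRing.Theory Num.Theory.
Local Open Scope ring_scope.

(** Let [E_l f] be the average of [f] over the leaves sharing the first [l] bits,
    and decompose [f = E_0 f + \sum_l d_l] with [d_l = E_l f - E_(l-1) f].  By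
    radial symmetry it is natural to extend each [d_l] separately, multiplying
    it at level [k] by the one-dimensional [p]-harmonic profile
    [1 - S_(k+1) / S_l], where [s_k = (2^k W_k)^(-1/(p-1))] and
    [S_l = s_l + ... + s_N].  The increment at level [k] is then [s_k G_k] with
    [G_k = \sum_(l <= k) d_l / S_l].  If [F] is any extension of [f] with
    increments [s_m a_m], then [|G_k|] is bounded by the sum over [m] of [s_m]
    times an average of [|a_m|] of total mass [2 / S_(min k m)].  This is a sum of
    two Hardy operators, bounded by [2 (p + q)] in [L^p] through the Schur test
    with weight [S^(-1/p)]. *)

(** * Power inequalities and the Schur test *)

Lemma conjugate_exponent_gt0 (R : realType) (p : R) : 1 < p -> 0 < 1 - p^-1.
Proof. by move=> p1; rewrite subr_gt0 invf_lt1// (lt_trans ltr01). Qed.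

(** Young's inequality for [b] times the power [p - 1] of [t], multiplied by [p]. *)
Lemma powR_tangent (R : realType) (p b t : R) : 1 < p -> 0 <= b -> 0 <= t ->
  t `^ p + p * t `^ (p - 1) * (b - t) <= b `^ p.
Proof.
move=> p1 b0 t0; have p0 : 0 < p by lra.
have q0 := conjugate_exponent_gt0 _ _ p1.
have pq : p^-1 + (1 - p^-1)^-1^-1 = 1 by rewrite invrK; ring.
have young := @conjugate_powR R b (t `^ (p - 1)) p (1 - p^-1)^-1 b0
  (powR_ge0 _ _) p0 _ pq.
have {young} := young _; rewrite invr_gt0 => /(_ q0).
rewrite -powRrM invrK.
have -> : (p - 1) * (1 - p^-1)^-1 = p.
  have pm1 : p - 1 != 0 by lra.
  by field; apply/andP; split; lra.
move=> young.
have {young} : p * (b * t `^ (p - 1)) <= p * (b `^ p / p + t `^ p * (1 - p^-1)).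
  by rewrite ler_pM2l.
have -> : p * (b `^ p / p + t `^ p * (1 - p^-1)) = b `^ p + (p - 1) * t `^ p.
  by field; lra.
have := @mulr_powRB1 R t p t0 p0; nra.
Qed.

(** Jensen's inequality for unnormalised weights: tangents are taken at the weighted mean
    [t = c / m], where the linear terms cancel. Total mass 0 is treated apart. *)
Lemma powR_sum_le (R : realType) (I : finType) (w b : I -> R) (p : R) :
  1 < p -> (forall i, 0 <= w i) -> (forall i, 0 <= b i) ->
  (\sum_i w i * b i) `^ p <= (\sum_i w i) `^ (p - 1) * \sum_i w i * b i `^ p.
Proof.
move=> p1 w0 b0; set c := \sum_i w i * b i; set m := \sum_i w i.
have p0 : 0 < p by lra.
have c0 : 0 <= c by apply: sumr_ge0 => i _; rewrite mulr_ge0.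
have m0 : 0 <= m by apply: sumr_ge0.
have d0 : 0 <= \sum_i w i * b i `^ p.
  by apply: sumr_ge0 => i _; rewrite mulr_ge0 ?powR_ge0.
have [m_eq0|m_neq0] := eqVneq m 0.
  have w_eq0 : forall i, w i = 0.
    by move=> i; move/eqP: m_eq0; rewrite psumr_eq0// => /allP/(_ i);
      rewrite mem_index_enum => /(_ isT)/eqP.
  have -> : c = 0 by rewrite /c big1// => i _; rewrite w_eq0 mul0r.
  by rewrite powR0 ?mulr_ge0 ?powR_ge0// gt_eqF.
have m_gt0 : 0 < m by rewrite lt_neqAle eq_sym m_neq0.
pose t := c / m.
have t0 : 0 <= t by rewrite divr_ge0.
have mt : m * t = c by rewrite mulrC divfK.
have : \sum_i w i * (t `^ p + p * t `^ (p - 1) * (b i - t)) <=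
       \sum_i w i * b i `^ p.
  by apply: ler_sum => i _; apply: ler_wpM2l => //; exact: powR_tangent.
have -> : \sum_i w i * (t `^ p + p * t `^ (p - 1) * (b i - t)) = m * t `^ p.
  transitivity (m * t `^ p + p * t `^ (p - 1) * (c - m * t)).
    rewrite /m /c mulr_suml mulr_suml -sumrB mulr_sumr -big_split/=.
    by apply: eq_bigr => i _; ring.
  by rewrite mt subrr mulr0 addr0.
move=> tangent.
have -> : c `^ p = m `^ (p - 1) * (m * t `^ p).
  by rewrite mulrA [_ * m]mulrC mulr_powRB1// -powRM// mt.
by rewrite ler_wpM2l// powR_ge0.
Qed.

(** Jensen's inequality is applied to [a = u * (a / u)] with weights [K i j * mu j * u j]. The row
    bound controls their total mass; after exchanging the sums, the column bound gives the last
    factor [C]. *)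
Lemma schur_test (R : realType) (I : finType) (mu u a : I -> R)
    (K : I -> I -> R) (C p : R) :
  1 < p -> 0 < C -> (forall i, 0 <= mu i) -> (forall i, 0 < u i) ->
  (forall i j, 0 <= K i j) -> (forall i, 0 <= a i) ->
  (forall i, \sum_j K i j * mu j * u j <= C * u i) ->
  (forall j, \sum_i mu i * K i j * u i `^ (p - 1) <= C * u j `^ (p - 1)) ->
  \sum_i mu i * (\sum_j K i j * mu j * a j) `^ p <=
    C `^ p * \sum_j mu j * a j `^ p.
Proof.
move=> p1 C0 mu0 u0 K0 a0 row col.
have p0 : 0 < p by lra.
have w0 i j : 0 <= K i j * mu j * u j by rewrite !mulr_ge0// ltW.
apply: (@le_trans _ _ (\sum_i mu i * ((C * u i) `^ (p - 1) *
  \sum_j K i j * mu j * u j * (a j / u j) `^ p))).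
  apply: ler_sum => i _; apply: ler_wpM2l => //.
  have -> : \sum_j K i j * mu j * a j =
            \sum_j K i j * mu j * u j * (a j / u j).
    by apply: eq_bigr => j _; field; rewrite gt_eqF.
  apply: (le_trans (@powR_sum_le R I (fun j => K i j * mu j * u j)
    (fun j => a j / u j) p p1 (w0 i) _)).
    by move=> j; rewrite divr_ge0// ltW.
  apply: ler_wpM2r.
    by apply: sumr_ge0 => j _; rewrite mulr_ge0// powR_ge0.
  apply: ge0_ler_powR => //; first lra.
  - by rewrite nnegrE sumr_ge0.
  - by rewrite nnegrE mulr_ge0// ltW.
have -> : \sum_i mu i * ((C * u i) `^ (p - 1) *
    \sum_j K i j * mu j * u j * (a j / u j) `^ p) =
  \sum_j C `^ (p - 1) * mu j * u j * (a j / u j) `^ p *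
    \sum_i mu i * K i j * u i `^ (p - 1).
  under eq_bigr do rewrite mulr_sumr mulr_sumr.
  rewrite exchange_big/=; apply: eq_bigr => j _.
  rewrite mulr_sumr; apply: eq_bigr => i _.
  by rewrite powRM ?ltW//; ring.
rewrite mulr_sumr; apply: ler_sum => j _.
have ap : (a j / u j) `^ p * u j `^ p = a j `^ p.
  by rewrite -powRM ?divr_ge0 ?divfK ?gt_eqF// ltW.
apply: (@le_trans _ _ (C `^ (p - 1) * mu j * u j * (a j / u j) `^ p *
   (C * u j `^ (p - 1)))).
  apply: ler_wpM2l => //.
  by rewrite !mulr_ge0 ?powR_ge0// ltW.
rewrite -ap -(@mulr_powRB1 R C p (ltW C0) p0).
rewrite -(@mulr_powRB1 R (u j) p (ltW (u0 j)) p0).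
by rewrite le_eqVlt; apply/orP; left; apply/eqP; ring.
Qed.

(** * Hardy row sums for tails of a positive sequence *)

(** The tangent at [a] to the concave power [1 - t], again from Young's inequality; [b = 0] is
    allowed because the last tail vanishes. *)
Lemma powR_step_pos (R : realType) (t a b : R) :
  0 < t < 1 -> 0 < a -> 0 <= b ->
  (a - b) * a `^ (- t) <= (1 - t)^-1 * (a `^ (1 - t) - b `^ (1 - t)).
Proof.
move=> /andP[t0 t1] a0 b0; have t1' : 0 < 1 - t by lra.
have pq : t^-1^-1 + (1 - t)^-1^-1 = 1 by rewrite !invrK; ring.
have ti : 0 < t^-1 by rewrite invr_gt0.
have ti' : 0 < (1 - t)^-1 by rewrite invr_gt0.
have := @conjugate_powR R (a `^ t) (b `^ (1 - t)) t^-1 (1 - t)^-1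
  (powR_ge0 _ _) (powR_ge0 _ _) ti ti' pq.
rewrite -!powRrM !invrK !mulfV ?gt_eqF// !powRr1 ?(ltW a0)// => young.
rewrite ler_pdivlMl// powRB ?(gt_eqF a0) ?implybT// powRr1 ?(ltW a0)// powRN.
have A0 : 0 < a `^ t by rewrite powR_gt0.
have : b `^ (1 - t) <= (a * t + b * (1 - t)) / a `^ t.
  by rewrite ler_pdivlMr// mulrC.
by rewrite mulrDl -!mulrA; lra.
Qed.

(** The tangent at [a] to the convex power [- t]. It comes from [1 + x <= expR x], used at
    [ln (b / a)] and at [- t * ln (b / a)]. *)
Lemma powR_step_neg (R : realType) (t a b : R) :
  0 < t -> 0 < a -> 0 < b ->
  (a - b) / a * a `^ (- t) <= t^-1 * (b `^ (- t) - a `^ (- t)).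
Proof.
move=> t0 a0 b0; rewrite ler_pdivlMl//.
have r0 : 0 < b / a by rewrite divr_gt0.
have -> : b `^ (- t) = (b / a) `^ (- t) * a `^ (- t).
  by rewrite -powRM ?ltW// divfK// gt_eqF.
have -> : (a - b) / a = 1 - b / a by field; rewrite gt_eqF.
have ln_le : ln (b / a) <= b / a - 1.
  by have := expR_ge1Dx (ln (b / a)); rewrite lnK ?posrE//; lra.
have : 1 + (- t) * ln (b / a) <= (b / a) `^ (- t).
  by rewrite /powR gt_eqF// expR_ge1Dx.
have : 0 < a `^ (- t) by rewrite powR_gt0.
set A := a `^ _; set B := _ `^ (- t) => A0 hB.
have {hB} : 1 + t * (1 - b / a) <= B by nra.
nra.
Qed.

Definition tail_sum (R : realType) (s : nat -> R) (N k : nat) : R :=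
  \sum_(k <= j < N.+1) s j.

Section Tail.
Variables (R : realType) (s : nat -> R) (N : nat).
Hypothesis s_gt0 : forall k, (1 <= k <= N)%N -> 0 < s k.
Local Notation S := (tail_sum R s N).

Lemma tail_sumS k : (k <= N)%N -> S k = s k + S k.+1.
Proof. by move=> kN; rewrite /tail_sum big_nat_recl// big_add1. Qed.

Lemma tail_sum_last : S N.+1 = 0.
Proof. by rewrite /tail_sum big_geq. Qed.

Lemma tail_sum_ge0 k : (1 <= k)%N -> 0 <= S k.
Proof.
move=> k1; rewrite /tail_sum big_nat_cond; apply: sumr_ge0 => j /andP[jN _].
by apply/ltW/s_gt0; lia.
Qed.

Lemma tail_sum_gt0 k : (1 <= k <= N)%N -> 0 < S k.
Proof.
move=> kN; rewrite tail_sumS ?ltr_wpDr ?s_gt0 ?tail_sum_ge0//; lia.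
Qed.

(** Since [s m = S m - S m.+1], the terms are bounded by increments of the power [- t] of [S] for
    [m < k], and of the power [1 - t] for [m >= k]. Both sums telescope. *)
Lemma hardy_row_sum t k : 0 < t < 1 -> (1 <= k <= N)%N ->
  \sum_(1 <= m < N.+1) s m / S (minn k m) * S m `^ (- t) <=
  (t^-1 + (1 - t)^-1) * S k `^ (- t).
Proof.
move=> t01 kN; have /andP[t0 t1] := t01.
have Sk0 := tail_sum_gt0 k kN.
have step m : (1 <= m <= N)%N -> s m = S m - S m.+1.
  by move=> mN; rewrite tail_sumS; [ring|lia].
rewrite (@big_cat_nat _ _ _ k)/=; [|lia|lia]; rewrite mulrDl.
apply: lerD.
- apply: (@le_trans _ _ (\sum_(1 <= m < k)
    (t^-1 * S m.+1 `^ (- t) - t^-1 * S m `^ (- t)))).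
    apply: ler_sum_nat => m mk.
    have -> : minn k m = m by lia.
    rewrite -mulrBr step; last lia.
    by apply: powR_step_neg => //; apply: tail_sum_gt0; lia.
  rewrite (telescope_sumr (fun m => t^-1 * S m `^ (- t))); last lia.
  by rewrite gerBl// mulr_ge0 ?powR_ge0// invr_ge0 ltW.
- apply: (@le_trans _ _ (\sum_(k <= m < N.+1)
    - (((1 - t)^-1 / S k) * S m.+1 `^ (1 - t) -
       ((1 - t)^-1 / S k) * S m `^ (1 - t)))).
    apply: ler_sum_nat => m mk.
    have -> : minn k m = k by lia.
    rewrite mulrAC mulrC [leRHS](_ : _ = (S k)^-1 *
      ((1 - t)^-1 * (S m `^ (1 - t) - S m.+1 `^ (1 - t)))); last by ring.
    rewrite ler_wpM2l ?invr_ge0 ?(ltW Sk0)// step; last lia.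
    by apply: powR_step_pos => //; [apply: tail_sum_gt0|apply: tail_sum_ge0];
      lia.
  rewrite sumrN (telescope_sumr (fun m => ((1 - t)^-1 / S k) * S m `^ (1 - t)));
    last lia.
  (* The power of [S N.+1 = 0] is 0 because [1 - t] is nonzero, so only the term at [k] survives. *)
  rewrite tail_sum_last powR0 ?subr_eq0 1?eq_sym ?lt_eqF// mulr0 sub0r opprK.
  rewrite powRB ?(gt_eqF Sk0) ?implybT// powRr1 ?(ltW Sk0)// powRN.
  rewrite le_eqVlt; apply/orP; left; apply/eqP.
  have := powR_gt0 t Sk0 => P0; field.
  by apply/and3P; split; rewrite ?gt_eqF ?subr_gt0.
Qed.

End Tail.

(** * Averages over leaves with a common prefix *)

Lemma card_tuple_prefix (N k : nat) (w : seq bool) : (k <= N)%N -> size w = k ->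
  #|[set z : N.-tuple bool | take k z == w]%SET| = (2 ^ (N - k))%N.
Proof.
move=> kN sw; have eN : (size w + (N - k))%N = N by lia.
pose ext (t : (N - k).-tuple bool) : N.-tuple bool :=
  tcast eN (cat_tuple (in_tuple w) t).
have ext_val t : val (ext t) = w ++ t by rewrite /ext/= val_tcast.
have ext_inj : injective ext.
  move=> t t' /(congr1 val); rewrite !ext_val => /eqP.
  by rewrite eqseq_cat// => /andP[_ /eqP tt']; apply: val_inj.
have -> : [set z : N.-tuple bool | take k z == w]%SET = (ext @: [set: (N - k).-tuple bool])%SET.
  apply/setP => z; rewrite inE; apply/eqP/imsetP => [zw|[t _ ->]].
    have sz : size (drop k z) == (N - k)%N by rewrite size_drop size_tuple.
    exists (Tuple sz) => //; apply: val_inj.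
    by rewrite ext_val -zw cat_take_drop.
  by rewrite ext_val take_size_cat.
by rewrite card_imset// cardsT card_tuple card_bool.
Qed.

(* The kernel of the conditional expectation onto functions of the first [l]
   bits, with respect to the counting measure on the leaves. *)
Definition cond_ker (R : realType) (N l : nat) (x z : seq bool) : R :=
  if take l x == take l z then 2 ^+ l / 2 ^+ N else 0.

Section CondKer.
Variables (R : realType) (N : nat).
Local Notation Q := (cond_ker R N).

Lemma cond_ker_sym l x z : Q l x z = Q l z x.
Proof. by rewrite /cond_ker eq_sym. Qed.

Lemma cond_ker_ge0 l x z : 0 <= Q l x z.
Proof. by rewrite /cond_ker; case: ifP => // _; rewrite divr_ge0// exprn_ge0. Qed.

Lemma cond_ker_take l k x z : (l <= k)%N -> Q l (take k x) z = Q l x z.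
Proof. by move=> lk; rewrite /cond_ker take_takel. Qed.

Lemma sum_cond_ker l x : (l <= N)%N -> (l <= size x)%N ->
  \sum_(z : leaf N) Q l x z = 1.
Proof.
move=> lN lx; rewrite /cond_ker -big_mkcond/= sumr_const.
transitivity ((2 ^+ l / 2 ^+ N : R) *+
    #|[set z : N.-tuple bool | take l z == take l x]%SET|).
  by congr (_ *+ _); apply: eq_card => z; rewrite !inE eq_sym.
rewrite card_tuple_prefix//; last by rewrite size_takel.
rewrite -[LHS]mulr_natr natrX mulrAC -exprD subnKC// mulfV//.
Qed.

Lemma cond_ker_prefix l m (z : leaf N) (F : vertex N -> R) :
  (m <= l)%N -> (l <= N)%N ->
  \sum_(y : leaf N) Q l z y * F (prefix_of m y) = F (prefix_of m z).
Proof.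
move=> ml lN; transitivity (\sum_(y : leaf N) Q l z y * F (prefix_of m z)).
  apply: eq_bigr => y _; rewrite /cond_ker; case: eqP => [zy|]; last by rewrite !mul0r.
  congr (_ * F _); apply: val_inj => /=.
  by rewrite -(take_takel z ml) zy take_takel.
by rewrite -mulr_suml sum_cond_ker ?mul1r// size_tuple.
Qed.

Lemma prefix_of_leaf (z : leaf N) : prefix_of N z = z.
Proof. by apply: val_inj; rewrite /= take_oversize ?size_tuple. Qed.

(** Each vertex of level [k] has [2 ^ (N - k)] leaves below it, so the sums over all levels move to
    the single space of leaves. *)
Lemma sum_level k (phi : vertex N -> R) : (k <= N)%N ->
  \sum_(x in level N k) phi x =
  2 ^+ k / 2 ^+ N * \sum_(z : leaf N) phi (prefix_of k z).
Proof.
move=> kN; rewrite (partition_big (fun z : leaf N => prefix_of k z)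
  (fun x => x \in level N k))/=; last first.
  by move=> z _; rewrite inE/= size_takel// size_tuple.
rewrite mulr_sumr; apply: eq_bigr => x; rewrite inE => /eqP sx.
under eq_bigr => z /eqP -> do [].
rewrite sumr_const.
transitivity ((2 ^+ k / 2 ^+ N : R) * (phi x *+
    #|[set z : N.-tuple bool | take k z == x]%SET|)).
  rewrite card_tuple_prefix// -[phi x *+ _]mulr_natr natrX mulrCA.
  by rewrite [2 ^+ k / _ * _]mulrAC -exprD subnKC// mulfV ?mulr1.
by congr (_ * (_ *+ _)); apply: eq_card => z; rewrite !inE.
Qed.

End CondKer.

(** * The extension kernel and its increments *)

(* The kernel taking a function to the level-[r] increment of its extension,
   divided by [s r]. *)
Definition grad_ker (R : realType) (N : nat) (S : nat -> R) (r : nat)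
    (x z : seq bool) : R :=
  \sum_(1 <= l < r.+1) (cond_ker R N l x z - cond_ker R N l.-1 x z) / S l.

(* The factor [1 - S k.+1 / S l] is the minimiser [h] of
   [\sum_(l <= j < N.+1) 2 ^+ j * W j * `|h j - h j.-1| `^ p] subject to
   [h l.-1 = 0] and [h N = 1]. *)
Definition ext_ker (R : realType) (N : nat) (S : nat -> R)
    (x z : seq bool) : R :=
  cond_ker R N 0 x z + \sum_(1 <= l < (size x).+1)
    (1 - S (size x).+1 / S l) * (cond_ker R N l x z - cond_ker R N l.-1 x z).

Section Kernels.
Variables (R : realType) (s : nat -> R) (N : nat).
Hypothesis s_gt0 : forall k, (1 <= k <= N)%N -> 0 < s k.
Local Notation S := (tail_sum R s N).
Local Notation Q := (cond_ker R N).
Local Notation D := (grad_ker R N S).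

Lemma grad_kerS r x z :
  D r.+1 x z = D r x z + (Q r.+1 x z - Q r x z) / S r.+1.
Proof. by rewrite /grad_ker big_nat_recr. Qed.

Lemma grad_ker_sym r x z : D r x z = D r z x.
Proof.
by apply: eq_bigr => l _; rewrite !(cond_ker_sym _ _ _ x z).
Qed.

Lemma sum_grad_ker r x : (r <= N)%N -> (r <= size x)%N ->
  \sum_(z : leaf N) D r x z = 0.
Proof.
move=> rN rx; rewrite /grad_ker exchange_big/= big_nat big1// => l lr.
by rewrite -mulr_suml sumrB !sum_cond_ker ?subrr ?mul0r//; lia.
Qed.

(** Induction on [r]: the new term [- Q r / S r.+1] absorbs the previous bound [Q r / S r], because
    [S] decreases. *)
Lemma grad_ker_le r x z : (1 <= r <= N)%N -> D r x z <= Q r x z / S r.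
Proof.
elim: r => [//|r IH rN].
have S0 : 0 < S r.+1 by apply: tail_sum_gt0.
rewrite grad_kerS mulrBl addrA addrAC -[leRHS]add0r lerD2r subr_le0.
case: r => [|r] in IH rN S0 *.
  by rewrite /grad_ker big_geq// divr_ge0 ?cond_ker_ge0 ?ltW.
apply: (le_trans (IH _)); first lia.
apply: ler_wpM2l; first exact: cond_ker_ge0.
rewrite lef_pV2 ?posrE//; last by apply: tail_sum_gt0 => //; lia.
by rewrite [leRHS]tail_sumS ?lerDr ?ltW ?s_gt0//; lia.
Qed.

(** From [D <= Q / S] and [|D| = 2 * max(D, 0) - D] follows [|D| <= 2 * Q / S - D]. Keeping [- D] is
    free on summation, since [D] has sum zero over the leaves. *)
Definition grad_majorant r x z : R := 2 * Q r x z / S r - D r x z.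

Lemma grad_ker_majorant r x z : (1 <= r <= N)%N ->
  `|D r x z| <= grad_majorant r x z.
Proof.
move=> rN; have := grad_ker_le r x z rN.
have : 0 <= Q r x z / S r.
  by rewrite divr_ge0 ?cond_ker_ge0 ?tail_sum_ge0//; lia.
rewrite /grad_majorant ler_norml -mulrA => Q0 DQ.
by apply/andP; split; lra.
Qed.

Lemma sum_grad_majorant r x : (r <= N)%N -> (r <= size x)%N ->
  \sum_(z : leaf N) grad_majorant r x z = 2 / S r.
Proof.
move=> rN rx; rewrite sumrB sum_grad_ker// subr0 -mulr_suml -mulr_sumr.
by rewrite sum_cond_ker// mulr1.
Qed.

(** At a leaf all factors [1 - S N.+1 / S l] are 1, and the sum telescopes to [Q N], the identity
    kernel. *)
Lemma ext_ker_leaf (x z : leaf N) : ext_ker R N S x z = (x == z)%:R.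
Proof.
rewrite /ext_ker size_tuple tail_sum_last.
under eq_bigr do rewrite mul0r subr0 mul1r.
rewrite big_add1/= (telescope_sumr (fun l => Q l x z))// addrC subrK.
rewrite /cond_ker !take_oversize ?size_tuple// -val_eqE/=.
by case: ifP => // _; rewrite mulfV//.
Qed.

Lemma ext_ker_diff k (x : leaf N) z : (1 <= k <= N)%N ->
  ext_ker R N S (take k x) z - ext_ker R N S (take k.-1 x) z =
  s k * D k x z.
Proof.
move=> kN; rewrite /ext_ker !size_takel ?size_tuple; try lia.
rewrite !cond_ker_take// opprD addrACA subrr add0r prednK; last lia.
have Sk : S k = s k + S k.+1 by rewrite tail_sumS//; lia.
(* The parent's sum is extended to [l = k], whose factor [1 - S k / S k] is zero; the factors of the
   two sums then differ by [s k / S l]. *)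
rewrite [X in _ - X](_ : _ = \sum_(1 <= l < k.+1)
    (1 - S k / S l) * (Q l x z - Q l.-1 x z)); last first.
  rewrite big_nat_recr/=; last lia.
  rewrite divff ?gt_eqF ?tail_sum_gt0// subrr mul0r addr0.
  by apply: eq_big_nat => l lk; rewrite !cond_ker_take//; lia.
rewrite -sumrB /grad_ker mulr_sumr; apply: eq_big_nat => l lk.
rewrite !cond_ker_take; try lia.
have : S l != 0 by rewrite gt_eqF ?tail_sum_gt0//; lia.
by rewrite Sk => Sl; field.
Qed.

(** For [l > m] both averages in the [l]-th term of [D k] fix functions of the first [m] bits, so
    these terms cancel. *)
Lemma grad_ker_prefix k m (x : leaf N) (F : vertex N -> R) :
  (k <= N)%N ->
  \sum_(y : leaf N) D k x y * F (prefix_of m y) =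
  \sum_(y : leaf N) D (minn k m) x y * F (prefix_of m y).
Proof.
move=> kN; have [//|mk] := leqP k m.
rewrite /grad_ker; under eq_bigr do rewrite mulr_suml.
rewrite exchange_big/= (@big_cat_nat _ _ _ m.+1)//=; last lia.
rewrite [X in _ + X]big_nat [X in _ + X]big1 ?addr0 => [|l lk].
  by rewrite exchange_big; apply: eq_bigr => y _; rewrite mulr_suml.
transitivity ((\sum_(y : leaf N) Q l x y * F (prefix_of m y)
  - \sum_(y : leaf N) Q l.-1 x y * F (prefix_of m y)) / S l).
  by rewrite -sumrB mulr_suml; apply: eq_bigr => y _; ring.
by rewrite !cond_ker_prefix ?subrr ?mul0r//; lia.
Qed.

(** [F] is telescoped along the path from the root to each leaf. By [grad_ker_prefix] both ends of
    the [m]-th edge can be paired with [D (minn k m)]; the root contributes nothing because [D 0] is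
    an empty sum. *)
Lemma grad_ker_diff k (x : leaf N) (F : vertex N -> R) : (k <= N)%N ->
  \sum_(y : leaf N) D k x y * F y =
  \sum_(1 <= m < N.+1) \sum_(y : leaf N)
    D (minn k m) x y * (F (prefix_of m y) - F (prefix_of m.-1 y)).
Proof.
move=> kN.
pose T m := \sum_(y : leaf N) D k x y * F (prefix_of m y).
transitivity (T N - T 0%N).
  rewrite {2}/T grad_ker_prefix// minn0.
  rewrite [X in _ - X]big1 ?subr0 => [|y _]; last first.
    by rewrite /grad_ker big_geq// mul0r.
  by apply: eq_bigr => y _; rewrite prefix_of_leaf.
rewrite -(telescope_sumr T)// big_add1/=; apply: eq_bigr => m _.
rewrite /T grad_ker_prefix// [X in _ - X](_ : _ =
  \sum_(y : leaf N) D (minn k m.+1) x y * F (prefix_of m y)).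
  by rewrite -sumrB; apply: eq_bigr => y _; ring.
rewrite grad_ker_prefix// [RHS]grad_ker_prefix; last lia.
by have -> : minn (minn k m.+1) m = minn k m by lia.
Qed.

End Kernels.

(** * The energy estimate for the extension *)

Lemma grad_majorant_sym (R : realType) (s : nat -> R) N r x z :
  grad_majorant R s N r x z = grad_majorant R s N r z x.
Proof. by rewrite /grad_majorant cond_ker_sym grad_ker_sym. Qed.

(** Rows and columns in the Schur test are Hardy sums with [t = p^-1] and [t = 1 - p^-1], which
    share the constant [p + q]; the factor 2 is the mass of the majorant. *)
Lemma grad_majorant_energy (R : realType) (s : nat -> R) (N : nat) (p : R)
    (a : nat -> leaf N -> R) :
  1 < p -> (forall k, (1 <= k <= N)%N -> 0 < s k) ->
  (forall k z, 0 <= a k z) ->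
  \sum_(1 <= k < N.+1) s k * \sum_(z : leaf N) (\sum_(1 <= m < N.+1)
    \sum_(y : leaf N) grad_majorant R s N (minn k m) z y * s m * a m y) `^ p <=
  (2 * (p + (1 - p^-1)^-1)) `^ p *
    \sum_(1 <= m < N.+1) s m * \sum_(y : leaf N) a m y `^ p.
Proof.
move=> p1 s_gt0 a0; set C := 2 * _.
have p0 : 0 < p by lra.
have q0 := conjugate_exponent_gt0 R p p1.
have C0 : 0 < C by rewrite mulr_gt0// addr_gt0// invr_gt0.
pose S := tail_sum R s N.
have S_gt0 k : (k < N)%N -> 0 < S k.+1 by move=> kN; apply: tail_sum_gt0.
(* An ordinal [i] stands for the level [i.+1], so levels run from 1 to [N]. *)
pose I : finType := ('I_N * leaf N)%type.
pose mu (i : I) := s i.1.+1.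
pose u (i : I) := S i.1.+1 `^ (- p^-1).
pose K (i j : I) := grad_majorant R s N (minn i.1.+1 j.1.+1) i.2 j.2.
have pairs (G : nat -> leaf N -> R) :
    \sum_(1 <= k < N.+1) \sum_(z : leaf N) G k z = \sum_(i : I) G i.1.+1 i.2.
  by rewrite big_add1 big_mkord pair_bigA.
have row t (i : I) : 0 < t < 1 ->
    \sum_j K i j * (s j.1.+1 * S j.1.+1 `^ (- t)) <=
    2 * (t^-1 + (1 - t)^-1) * S i.1.+1 `^ (- t).
  move=> t01; have iN := ltn_ord i.1.
  rewrite -(pair_bigA _ (fun (m : 'I_N) (y : leaf N) => grad_majorant R s N (minn i.1.+1 m.+1) i.2 y
    * (s m.+1 * S m.+1 `^ (- t))))/=.
  have := hardy_row_sum R s N s_gt0 t i.1.+1 t01 iN.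
  rewrite big_add1 big_mkord -mulrA => hardy.
  have {hardy} := ler_wpM2l (ler0n R 2) hardy; apply: le_trans.
  rewrite mulr_sumr; apply: ler_sum => m _; have mN := ltn_ord m.
  rewrite -mulr_suml sum_grad_majorant ?size_tuple; [|lia|lia].
  by rewrite le_eqVlt; apply/orP; left; apply/eqP; rewrite /S; ring.
have pin : 0 < p^-1 < 1 by rewrite invr_gt0 p0 invf_lt1.
have upow : forall i : I, u i `^ (p - 1) = S i.1.+1 `^ (- (1 - p^-1)).
  by move=> j; rewrite /u -powRrM; congr (_ `^ _); field; lra.
have : \sum_i mu i * (\sum_j K i j * mu j * a j.1.+1 j.2) `^ p <=
    C `^ p * \sum_j mu j * a j.1.+1 j.2 `^ p.
  apply: (@schur_test R I mu u (fun i : I => a i.1.+1 i.2)) => //.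
  - by move=> i; rewrite ltW// s_gt0//=.
  - by move=> i; rewrite powR_gt0// S_gt0.
  - move=> i j; apply: le_trans (normr_ge0 _) (grad_ker_majorant _ _ _ _ _ _ _ _) => //.
    by have := ltn_ord i.1; lia.
  - move=> i; under eq_bigr do rewrite -mulrA.
    by apply: le_trans (row _ _ pin) _; rewrite invrK.
  (* The kernel is symmetric, so the column bound is a row bound for the complementary exponent. *)
  - move=> j; rewrite upow.
    have pin' : 0 < 1 - p^-1 < 1 by lra.
    apply: le_trans (le_trans _ (row _ j pin')) _; last first.
      by rewrite subKr invrK [_^-1 + p]addrC.
    rewrite le_eqVlt; apply/orP; left; apply/eqP; apply: eq_bigr => i _.
    by rewrite upow /K minnC grad_majorant_sym /mu; ring.
under [in X in _ -> X]eq_bigr do rewrite mulr_sumr.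
under [in X in _ -> X]eq_bigr do under eq_bigr do rewrite pairs.
under [X in _ -> _ <= _ * X]eq_bigr do rewrite mulr_sumr.
by rewrite !pairs.
Qed.

(** The exponent in [s] makes [2 ^+ k * W k] times the [p]-th power of [s k] equal to [s k]. Hence
    increments divided by [s] are measured in [L^p] with [s] itself as the weight, as the Schur test
    requires. *)
Lemma sobolev_norm_leaf (R : realType) (N : nat) (W s : nat -> R) (p : R)
    (F : vertex N -> R) :
  1 < p -> (forall k, (1 <= k <= N)%N -> 0 < W k) ->
  (forall k, s k = (2 ^+ k * W k) `^ (- (p - 1)^-1)) ->
  sobolev_norm W p F = ((2 ^+ N)^-1 * \sum_(1 <= k < N.+1) s k *
    \sum_(z : leaf N)
      (`|F (prefix_of k z) - F (prefix_of k.-1 z)| / s k) `^ p) `^ p^-1.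
Proof.
move=> p1 W0 sE; rewrite /sobolev_norm mulr_sumr; congr (_ `^ _).
apply: eq_big_nat => k kN; rewrite sum_level; last lia.
have U0 : 0 < 2 ^+ k * W k by rewrite mulr_gt0 ?exprn_gt0// W0//; lia.
have s0 : 0 < s k by rewrite sE powR_gt0.
have UsE : 2 ^+ k * W k * s k `^ p = s k.
  have -> : 2 ^+ k * W k = s k `^ (1 - p).
    rewrite sE -powRrM -[LHS]powRr1 ?ltW//; congr (_ `^ _); field; lra.
  by rewrite -powRD ?(gt_eqF s0) ?implybT// subrK powRr1// ltW.
have scale (d : R) : 0 <= d -> W k * (2 ^+ k / 2 ^+ N * d `^ p) =
    (2 ^+ N)^-1 * (s k * (d / s k) `^ p).
  move=> d0; have -> : d `^ p = (d / s k) `^ p * s k `^ p.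
    by rewrite -powRM ?divr_ge0 ?(ltW s0)// divfK// gt_eqF.
  by rewrite -[s k * _](congr1 ( *%R^~ _) UsE); ring.
rewrite !mulr_sumr; apply: eq_bigr => z _.
have -> : prefix_of k.-1 (prefix_of k z) = prefix_of k.-1 z.
  by apply: val_inj; rewrite /= take_takel// leq_pred.
exact: scale.
Qed.

(** Only the leaf values of [F] enter on the left, so the extension is compared with all competitors
    at once. *)
Lemma sobolev_norm_ext_ker (R : realType) (N : nat) (W s : nat -> R) (p : R)
    (F : vertex N -> R) :
  1 < p -> (forall k, (1 <= k <= N)%N -> 0 < W k) ->
  (forall k, s k = (2 ^+ k * W k) `^ (- (p - 1)^-1)) ->
  sobolev_norm W p (fun x : vertex N =>
    \sum_(z : leaf N) ext_ker R N (tail_sum R s N) x z * F z) <=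
  2 * (p + (1 - p^-1)^-1) * sobolev_norm W p F.
Proof.
move=> p1 W0 sE; set C := 2 * _.
have p0 : 0 < p by lra.
have q0 := conjugate_exponent_gt0 R p p1.
have C0 : 0 < C by rewrite mulr_gt0// addr_gt0// invr_gt0.
have s_gt0 k : (1 <= k <= N)%N -> 0 < s k.
  by move=> kN; rewrite sE powR_gt0// mulr_gt0 ?exprn_gt0// W0.
have s_ge0 k : 0 <= s k by rewrite sE powR_ge0.
have N0 : 0 <= (2 ^+ N : R)^-1 by rewrite invr_ge0 exprn_ge0.
rewrite !(@sobolev_norm_leaf R N W s p)//.
set E := \sum_(1 <= k < N.+1) s k * _; set E' := \sum_(1 <= k < N.+1) s k * _.
have E_ge0 : 0 <= E.
  apply: sumr_ge0 => k _; rewrite mulr_ge0//.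
  by apply: sumr_ge0 => z _; rewrite powR_ge0.
have E'_ge0 : 0 <= E'.
  apply: sumr_ge0 => k _; rewrite mulr_ge0//.
  by apply: sumr_ge0 => z _; rewrite powR_ge0.
have CE : C = (C `^ p) `^ p^-1.
  by rewrite -powRrM mulfV ?gt_eqF// powRr1 ?ltW.
rewrite [C in leRHS]CE -powRM ?powR_ge0 ?mulr_ge0//.
apply: ge0_ler_powR; rewrite ?nnegrE ?invr_ge0 ?mulr_ge0 ?powR_ge0 ?(ltW p0)//.
rewrite mulrCA ler_wpM2l//.
apply: le_trans; last first.
  apply: (@grad_majorant_energy R s N p (fun m y =>
    `|F (prefix_of m y) - F (prefix_of m.-1 y)| / s m)) => // k z.
  by rewrite divr_ge0.
apply: ler_sum_nat => k kN; rewrite ler_wpM2l//; apply: ler_sum => z _.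
apply: ge0_ler_powR; rewrite ?nnegrE ?(ltW p0) ?divr_ge0//.
  rewrite big_nat; apply: sumr_ge0 => m mN; apply: sumr_ge0 => y _.
  rewrite -mulrA mulr_ge0// ?mulr_ge0 ?invr_ge0//.
  apply: le_trans (normr_ge0 _) (grad_ker_majorant _ _ _ _ _ _ _ _) => //; lia.
(* The factor [s k] from [ext_ker_diff] cancels the normalisation, and [grad_ker_diff] writes the
   rest through increments of [F]. *)
rewrite -sumrB; under eq_bigr do rewrite -mulrBl ext_ker_diff// -mulrA.
rewrite -mulr_sumr grad_ker_diff; last lia.
have sk : 0 < s k by apply: s_gt0; lia.
rewrite normrM gtr0_norm// mulrAC divff ?gt_eqF// mul1r.
apply: le_trans (ler_norm_sum _ _ _) _; apply: ler_sum_nat => m mN.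
apply: le_trans (ler_norm_sum _ _ _) _; apply: ler_sum => y _.
have sm : 0 < s m by apply: s_gt0; lia.
rewrite normrM -mulrA [s m * _]mulrC divfK ?gt_eqF// ler_wpM2r//.
by apply: grad_ker_majorant => //; lia.
Qed.

(** * The size of the constant, and the conclusion *)

(** As [p = q * (p - 1)], the first and last factors combine to the power [p^-1] of [q]. *)
Lemma conjugate_powR_prod (R : realType) (p q : R) :
  1 < p -> 1 < q -> p^-1 + q^-1 = 1 ->
  p `^ p^-1 * q `^ q^-1 * (p - 1) `^ (- p^-1) = q.
Proof.
move=> p1 q1 pq; have pE : p = q * (p - 1).
  by rewrite -[q]invrK (_ : q^-1 = 1 - p^-1); [field; lra | lra].
have pm1 : 0 < p - 1 by lra.
have q0 : 0 < q by lra.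
rewrite {1}pE powRM ?ltW// powRN mulrAC mulfK ?gt_eqF ?powR_gt0//.
by rewrite -powRD ?(gt_eqF q0) ?implybT// pq powRr1// ltW.
Qed.

(** With [X] the product of the two powers and [M = max(p, q)], [conjugate_powR_prod] turns the
    middle term into [4 * (X + M)]. It is at least [4 * M >= 2 * (p + q)], and at most [8 * M]
    because [X] is a weighted geometric mean. From [p * q = p + q] one gets [M >= 2], so
    [8 * M <= 16 * (M - 1)], where [M - 1] is the last maximum. *)
Lemma extension_constant (R : realType) (p q : R) : 1 < p -> q = p / (p - 1) ->
  2 * (p + q) <= 4 * p `^ p^-1 * q `^ q^-1 *
            (1 + Num.max ((p - 1) `^ (- p^-1)) ((q - 1) `^ (- q^-1)))
       <= 16 * Num.max (p - 1)^-1 (q - 1)^-1.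
Proof.
move=> p1 qE; have pm1 : 0 < p - 1 by lra.
have qm1E : q - 1 = (p - 1)^-1 by rewrite qE; field; lra.
have q1 : 1 < q by rewrite -subr_gt0 qm1E invr_gt0.
have pq : p^-1 + q^-1 = 1 by rewrite qE; field; apply/andP; split; lra.
have pqE : p * q = p + q by rewrite qE; field; lra.
rewrite -qm1E (_ : (q - 1)^-1 = p - 1); last by rewrite qm1E invrK.
have Xp := conjugate_powR_prod R p q p1 q1 pq.
have := conjugate_powR_prod R q p q1 p1; rewrite addrC => /(_ pq).
rewrite [q `^ _ * _]mulrC => Xq; rewrite -[4 * _ * _]mulrA.
have X0 : 0 <= p `^ p^-1 * q `^ q^-1 by rewrite mulr_ge0 ?powR_ge0.
have XM M : p <= M -> q <= M -> p `^ p^-1 * q `^ q^-1 <= M.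
  move=> pM qM; have M0 : 0 < M by lra.
  rewrite -[leRHS](powRr1 (ltW M0)) -pq powRD ?(gt_eqF M0) ?implybT//.
  by apply: ler_pM; rewrite ?powR_ge0//; apply: ge0_ler_powR;
    rewrite ?nnegrE ?invr_ge0//; lra.
move: X0 XM Xp Xq; set X := _ * _; set a := _ `^ _; set b := _ `^ _.
move=> X0 XM Xp Xq.
have [pq_le|qp_le] := leP p q.
- have {}XM := XM q pq_le (lexx q).
  have -> : Num.max (q - 1) (p - 1) = q - 1 by apply/max_idPl; lra.
  have [ab|ba] := leP a b; apply/andP; split; nra.
- have {}XM := XM p (lexx p) (ltW qp_le).
  have -> : Num.max (q - 1) (p - 1) = p - 1 by apply/max_idPr; lra.
  have [ab|ba] := leP a b; apply/andP; split; nra.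
Qed.

Theorem theorem1p1 (R : realType) :
  exists2 C : R, 0 < C &
  forall p : R, 1 < p -> forall q : R, q = p / (p - 1) ->
  exists Cp : R,
    Cp <= 4 * p `^ p^-1 * q `^ q^-1 *
            (1 + Num.max ((p - 1) `^ (- p^-1)) ((q - 1) `^ (- q^-1)))
       <= C * Num.max (p - 1)^-1 (q - 1)^-1 /\
    forall (N : nat) (W : nat -> R), (1 <= N)%N ->
      (forall k : nat, (1 <= k <= N)%N -> 0 < W k) ->
      exists H : {linear (leaf N -> R^o) -> (vertex N -> R^o)},
        (forall (f : leaf N -> R) (x : leaf N), H f x = f x) /\
        (forall f : leaf N -> R,
           sobolev_norm W p (H f) <= Cp * trace_norm W p f).
Proof.
exists 16 => // p p1 q qE.
exists (2 * (p + q)); split; first exact: extension_constant.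
move=> N W _ W0; pose s k := (2 ^+ k * W k) `^ (- (p - 1)^-1).
pose H (f : leaf N -> R^o) (x : vertex N) : R^o :=
  \sum_(z : leaf N) ext_ker R N (tail_sum R s N) x z * f z.
have H_linear : linear H.
  move=> c f g; apply/funext => x.
  rewrite /H -[RHS]/(c * _ + _) mulr_sumr -big_split/=.
  by apply: eq_bigr => z _; rewrite -[(_ + _) z]/(c * f z + g z); ring.
pose Hlin : {linear (leaf N -> R^o) -> (vertex N -> R^o)} :=
  HB.pack H (GRing.isLinear.Build R _ _ _ H H_linear).
exists Hlin.
have HlinE f : Hlin f = H f by [].
have H_ext f (x : leaf N) : H f x = f x.
  rewrite /H (bigD1 x)//= ext_ker_leaf eqxx mul1r big1 ?addr0// => z zx.
  by rewrite ext_ker_leaf eq_sym (negbTE zx) mul0r.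
split=> [f x|f]; first by rewrite HlinE H_ext.
have q0 : 0 < q by rewrite qE divr_gt0; lra.
have C0 : 0 < 2 * (p + q) by rewrite mulr_gt0// addr_gt0//; lra.
(* [H f] itself witnesses that the set under the infimum is nonempty. *)
rewrite HlinE -ler_pdivrMl//; apply: lb_le_inf.
  by exists (sobolev_norm W p (H f)); exists (H f) => // x; apply: H_ext.
move=> _ [F Ff <-]; rewrite ler_pdivrMl//.
have -> : q = (1 - p^-1)^-1 by rewrite qE; field; apply/andP; split; lra.
have -> : H f = fun x => \sum_(z : leaf N) ext_ker R N (tail_sum R s N) x z * F z.
  by apply/funext => x; apply: eq_bigr => z _; rewrite Ff.
exact: sobolev_norm_ext_ker.
Qed.
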